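(* Assume that for every periodic sequence $X$ of positive reals with some period $L$, and every $c\in[0,1]$, the limit $F_X(c):=\lim_{k\to\infty}F_X(k,c)$ exists and $c\mapsto F_X(c)$ is continuous on $[0,1]$. Let $f:\mathbb{N}\to\mathbb{N}_{\ge1}$ be an arithmetic function with $f(n)\le n$ and $f(n)=o(n)$. Then for Lebesgue-almost every irrational $\alpha\in(0,1)$, \[ \limsup_{n\to\infty}S(\alpha,n,f(n))^{1/f(n)}=\infty. \] If in addition, for almost every $\alpha$ and every $c\in(0,1]$, $\limsup_{n\to\infty}S(\alpha,n,cn)^{1/cn}=\liminf_{n\to\infty}S(\alpha,n,cn)^{1/cn}$, then the $\limsup$ may be replaced by a limit.
   Context: Every irrational $\alpha\in(0,1)$ has a unique continued fraction expansion $\alpha = 1/(a_1(\alpha)+1/(a_2(\alpha)+\cdots))$ with digits $a_i(\alpha)\in\mathbb{N}_{\ge1}$. For a sequence $X=(x_i)$ of positive reals and integers $1\le k\le n$, $S(X,n,k):=\binom{n}{k}^{-1}\sum_{1\le i_1<\cdots<i_k\le n}x_{i_1}\cdots x_{i_k}$; $S(\alpha,n,k)$ denotes this with $x_i=a_i(\alpha)$, and $S(\cdot,n,cn)^{1/cn}$ means $S(\cdot,n,\lceil cn\rceil)^{1/\lceil cn\rceil}$. For $X$ periodic with period $L$, $k\ge1$, $c\in(0,1]$: $F_X(k,c):=S(X,kL,\lceil ckL\rceil)^{1/\lceil ckL\rceil}$, and $F_X(k,0):=(x_1+\cdots+x_L)/L$. *)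

(* Defs.v *)
From HB Require Import structures.
From mathcomp Require Import all_boot all_order all_algebra.
From mathcomp Require Import all_classical all_reals all_analysis.
Set Implicit Arguments. Unset Strict Implicit. Unset Printing Implicit Defensive.
Import Order.TTheory GRing.Theory Num.Theory.
Local Open Scope ring_scope.

Section Defs.
Variable R : realType.

Definition gauss (x : R) : R := x^-1 - (Num.floor x^-1)%:~R.

(* n-th continued fraction digit a_n(x), n >= 1 (a_0 is junk):
   a_n(x) = floor(1 / T^(n-1) x), T the Gauss map. *)
Definition cfd (x : R) (n : nat) : nat := `|Num.floor (iter n.-1 gauss x)^-1|%N.

(* S(X,n,k) for a 1-indexed sequence X = (x 1, x 2, ...). *)
Definition Ssym (x : nat -> R) (n k : nat) : R :=
  ('C(n, k)%:R)^-1 *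
  \sum_(A : {set 'I_n} | #|A| == k) \prod_(i in A) x (val i).+1.

Definition Sroot (x : nat -> R) (n k : nat) : R := Ssym x n k `^ (k%:R^-1).

(* ceiling of a nonnegative real, as a natural number *)
Definition ceilN (r : R) : nat := `|Num.ceil r|%N.

Definition FX (x : nat -> R) (L k : nat) (c : R) : R :=
  if c == 0 then (\sum_(1 <= i < L.+1) x i) / L%:R
  else Sroot x (k * L) (ceilN (c * (k * L)%:R)).

Definition Salpha (a : R) (n k : nat) : R := Sroot (fun i => (cfd a i)%:R) n k.

Definition Salphac (a : R) (n : nat) (c : R) : R := Salpha a n (ceilN (c * n%:R)).


End Defs.

(* Main.v *)
Require Import Defs.
From HB Require Import structures.
From mathcomp Require Import all_boot all_order all_algebra.
From mathcomp Require Import all_classical all_reals all_analysis.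
From mathcomp Require Import ring lra.
Import Order.TTheory GRing.Theory Num.Theory numFieldNormedType.Exports.
Local Open Scope classical_set_scope.
Local Open Scope ring_scope.

(* For 0 <= x_i <= M, double counting k e_k = sum_B (prod_B x) (sum_(i notin B)
   x_i) bounds S(X,n,k)^(1/k) below by (x_1 + ... + x_n - k M) / n. Applied to
   the truncated digits a_i 1[a_i <= M] with k = f(n) = o(n), this reduces the
   claim to the following: for every C there is an M such that, for almost
   every a, the average of the first n truncated digits eventually exceeds C.
   Given a_1, ..., a_i, the digit a_(i+1) equals k with probability at least
   1/((k+1)(k+2)), so the truncated digits have conditional mean >= c log M; a
   Chernoff bound over continued fraction cylinders makes the measure of the
   exceptional set exponentially small in n, and Borel-Cantelli concludes. *)

(** * Lower bounds for elementary symmetric means *)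

(** Both sides sum over a set [A] with a marked element [i], where [B = A :\ i]. *)
Lemma elementary_symmetric_succ (R : comPzRingType) (T : finType) (x : T -> R)
    (k : nat) :
  k.+1%:R * (\sum_(A : {set T} | #|A| == k.+1) \prod_(i in A) x i) =
  \sum_(B : {set T} | #|B| == k)
    (\prod_(i in B) x i) * \sum_(i | i \notin B) x i.
Proof.
have -> : k.+1%:R * (\sum_(A : {set T} | #|A| == k.+1) \prod_(i in A) x i) =
    \sum_(A : {set T} | #|A| == k.+1) \sum_(i in A) \prod_(j in A) x j.
  rewrite mulr_sumr; apply: eq_bigr => A /eqP cA.
  by rewrite sumr_const cA mulr_natl.
under [RHS]eq_bigr do rewrite mulr_sumr.
rewrite (exchange_big_dep predT) //= [RHS](exchange_big_dep predT) //=.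
apply: eq_bigr => i _.
rewrite (reindex_onto (fun B : {set T} => i |: B) (fun A => A :\ i)) /=; last first.
  by move=> A /andP[_ iA]; rewrite finset.setD1K.
apply: eq_big => [B|B /andP[/andP[_ _] /eqP iB]].
  rewrite setU11 andbT cardsU1.
  case: (boolP (i \in B)) => iB /=.
    rewrite andbF; apply/negbTE; rewrite negb_and; apply/orP; right.
    by apply/eqP => E; move: iB; rewrite -E setD11.
  by rewrite add1n eqSS setU1K // eqxx andbT.
have iNB : i \notin B by rewrite -iB setD11.
by rewrite big_setU1 //= mulrC.
Qed.

(** Extending the sum over [i] outside [B] to all [i] adds [k] terms, each at most [M]. *)
Lemma Ssym_succ_ge {R : realType} (x : nat -> R) (M : R) (n k : nat) :
  (k < n)%N -> (forall i, 0 <= x i <= M) ->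
  Ssym x n k * (\sum_(i < n) x i.+1 - k%:R * M) <=
  (n - k)%:R * Ssym x n k.+1.
Proof.
move=> kn xM; rewrite /Ssym.
set e := fun j => \sum_(A : {set 'I_n} | #|A| == j) \prod_(i in A) x (val i).+1.
have binE : k.+1%:R * 'C(n, k.+1)%:R = (n - k)%:R * 'C(n, k)%:R :> R.
  by rewrite -!natrM mul_bin_left.
have b0 : 0 < 'C(n, k)%:R :> R by rewrite ltr0n bin_gt0 ltnW.
have b1 : 0 < 'C(n, k.+1)%:R :> R by rewrite ltr0n bin_gt0.
have k0 : 0 < k.+1%:R :> R by rewrite ltr0n.
have -> : (n - k)%:R * ('C(n, k.+1)%:R^-1 * e k.+1) =
    'C(n, k)%:R^-1 * (k.+1%:R * e k.+1).
  have -> : (n - k)%:R = k.+1%:R * 'C(n, k.+1)%:R / 'C(n, k)%:R :> R.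
    by rewrite binE mulfK // gt_eqF.
  by field; rewrite !gt_eqF.
rewrite -mulrA ler_pM2l ?invr_gt0 // elementary_symmetric_succ mulr_suml.
apply: ler_sum => B /eqP cB; apply: ler_wpM2l.
  by apply: prodr_ge0 => i _; have /andP[] := xM (val i).+1.
rewrite (bigID (fun i => i \in B)) /= addrAC gerDr subr_le0.
rewrite -cB mulr_natl -sumr_const; apply: ler_sum => i _.
by have /andP[] := xM (val i).+1.
Qed.

(** The hypothesis makes the factor in [Ssym_succ_ge] at least [(n - k) P], so each step of the
    induction on [k] gains a factor [P]. *)
Lemma Ssym_ge {R : realType} (x : nat -> R) (M P : R) (n k : nat) :
  (k <= n)%N -> (forall i, 0 <= x i <= M) -> 0 <= P ->
  n%:R * P + k%:R * M <= \sum_(i < n) x i.+1 ->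
  P ^+ k <= Ssym x n k.
Proof.
move=> + xM P0.
have M0 : 0 <= M by have /andP[a b] := xM 0%N; apply: le_trans a b.
elim: k => [_ _|k IH kn sP].
  rewrite expr0 /Ssym bin0 invr1 mul1r (big_pred1 finset.set0) ?big_set0 //.
  by move=> A; rewrite cards_eq0.
have {}IH : P ^+ k <= Ssym x n k.
  apply: IH; first exact: ltnW.
  by apply: le_trans sP; rewrite lerD2l ler_wpM2r // ler_nat.
have nk0 : 0 < (n - k)%:R :> R by rewrite ltr0n subn_gt0.
rewrite -(ler_pM2l nk0); apply: (le_trans _ (Ssym_succ_ge _ _ _ _ kn xM)).
have S0 : 0 <= Ssym x n k by apply: le_trans IH; exact: exprn_ge0.
rewrite exprS mulrA mulrC; apply: ler_pM => //.
- exact: exprn_ge0.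
- by rewrite mulr_ge0 // ltW.
- rewrite natrB; last exact: ltnW.
  move: sP; rewrite -natr1.
  have : 0 <= k%:R * P by rewrite mulr_ge0.
  lra.
Qed.

Lemma Sroot_ge {R : realType} (x y : nat -> R) (M P : R) (n k : nat) :
  (1 <= k <= n)%N -> (forall i, 0 <= y i <= M) -> (forall i, y i <= x i) ->
  n%:R * P + k%:R * M <= \sum_(i < n) y i.+1 ->
  P <= Sroot x n k.
Proof.
move=> /andP[k0 kn] yM yx sP.
have [P0|/ltW P0] := leP 0 P; last by apply: le_trans P0 _; exact: powR_ge0.
have le1 := Ssym_ge _ _ _ _ _ kn yM P0 sP.
have le2 : Ssym y n k <= Ssym x n k.
  apply: ler_wpM2l; first by rewrite invr_ge0.
  apply: ler_sum => A _; apply: ler_prod => i _.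
  by have /andP[-> _] := yM (val i).+1; rewrite yx.
have -> : P = (P ^+ k) `^ k%:R^-1.
  rewrite -powR_mulrn // -powRrM mulfV ?powRr1 //.
  by rewrite pnatr_eq0 -lt0n.
apply: ge0_ler_powR; rewrite ?invr_ge0 ?nnegrE //; first exact: exprn_ge0.
  by apply: le_trans le2; apply: le_trans le1; exact: exprn_ge0.
exact: le_trans le1 le2.
Qed.

(** * Truncated digits and lengths of digit cylinders *)

(** Digits above [M] become 0, not [M]: they carry the weight [r ^+ 0 = 1], so that only the digits
    up to [M] enter [decay_rate]. *)
Definition truncate (M k : nat) : nat := if (k <= M)%N then k else 0%N.

(* An upper bound for the conditional expectation of [r ^+ truncate M a_(i+1)]
   given the previous digits: the summands use the lower bound
   [1 / ((j+1) (j+2))] for the probability of the digit [j = k+1]. *)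
Definition decay_rate {R : realType} (M : nat) (r : R) : R :=
  1 - \sum_(k < M) (1 - r ^+ k.+1) / (k.+2%:R * k.+3%:R).

(* [((k q + q') ((k+1) q + q'))^-1] is, up to the determinant, the length of
   the image of the first digit cylinder [a_1 = k] under a Moebius map with
   denominator [q + q' y]. *)
Definition branch_length {R : realType} (q q' : R) (k : nat) : R :=
  ((k%:R * q + q') * (k.+1%:R * q + q'))^-1.

Lemma branch_length_ge0 {R : realType} (q q' : R) (k : nat) :
  0 < q -> 0 <= q' -> 0 <= branch_length q q' k.
Proof.
move=> q0 q'0; have d0 n : 0 <= n%:R * q + q' by rewrite addr_ge0 // mulr_ge0 // ltW.
by rewrite /branch_length invr_ge0 mulr_ge0.
Qed.

(** The sum telescopes: [branch_length q q' k] is [1/q] times the difference of [1/(k q + q')] and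
    [1/((k+1) q + q')]. *)
Lemma sum_branch_length {R : realType} (q q' : R) (N : nat) :
  0 < q -> 0 <= q' ->
  \sum_(k < N) branch_length q q' k.+1 <= (q * (q + q'))^-1.
Proof.
move=> q0 q'0.
have d0 n : 0 < n.+1%:R * q + q' by apply: ltr_wpDr => //; rewrite mulr_gt0.
suff -> : \sum_(k < N) branch_length q q' k.+1 =
    (q * (q + q'))^-1 - (q * (N.+1%:R * q + q'))^-1.
  by rewrite gerBl invr_ge0 mulr_ge0 // ltW.
elim: N => [|N IH]; first by rewrite big_ord0 mul1r subrr.
rewrite big_ord_recr /= IH /branch_length.
have := d0 N.+1; have := d0 N; have := d0 0%N.
rewrite -[N.+2%:R]natr1 mul1r; move: N.+1%:R => u a b c.
by field; rewrite !gt_eqF.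
Qed.

(** This is the lower bound for the conditional probability of a digit. It is uniform in the
    previous digits, because these enter only through [q] and [q'] with [0 <= q' <= q]. *)
Lemma branch_length_ge {R : realType} (q q' : R) (k : nat) :
  0 < q -> 0 <= q' <= q ->
  (q * (q + q'))^-1 / (k.+2%:R * k.+3%:R) <= branch_length q q' k.+1.
Proof.
move=> q0 /andP[q'0 q'q]; rewrite -invfM /branch_length.
have d0 n : 0 < n.+1%:R * q + q' by apply: ltr_wpDr => //; rewrite mulr_gt0.
have qq : 0 < q + q' by apply: ltr_wpDr.
rewrite lef_pV2 ?posrE ?mulr_gt0 //.
have -> : q * (q + q') * (k.+2%:R * k.+3%:R) = (k.+2%:R * q) * (k.+3%:R * (q + q')).
  by ring.
apply: ler_pM; rewrite ?(ltW (d0 _)) //.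
  by rewrite -[k.+2%:R]natr1 mulrDl mul1r lerD2l.
rewrite mulrDr; apply: lerD; first by rewrite ler_pM2r // ler_nat.
by rewrite -[leLHS]mul1r ler_wpM2r // ler1n.
Qed.

(** Write [r ^+ t = 1 - (1 - r ^+ t)]: the ones telescope, and [branch_length_ge] bounds the
    subtracted part from below. *)
Lemma sum_weighted_branch_length {R : realType} (q q' r : R) (M N : nat) :
  0 < q -> 0 <= q' <= q -> 0 <= r <= 1 ->
  \sum_(k < N) r ^+ truncate M k.+1 * branch_length q q' k.+1 <=
  decay_rate M r * (q * (q + q'))^-1.
Proof.
move=> q0 q'q /andP[r0 r1]; have /andP[q'0 _] := q'q.
set l := (q * (q + q'))^-1.
pose F k := r ^+ truncate M k.+1 * branch_length q q' k.+1.
have F0 k : 0 <= F k.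
  by rewrite mulr_ge0 ?exprn_ge0 // branch_length_ge0.
(* With [N + M] terms, every digit up to [M] occurs, even for small [N]. *)
apply: (@le_trans _ _ (\sum_(k < N + M) F k)).
  rewrite (big_ord_widen _ F (leq_addr M N)) big_mkcond /=.
  by apply: ler_sum => k _; case: ifP.
apply: (@le_trans _ _ (\sum_(k < N + M) (branch_length q q' k.+1 -
   (if (k < M)%N then (1 - r ^+ k.+1) / (k.+2%:R * k.+3%:R) * l else 0)))).
  apply: ler_sum => k _; rewrite /F /truncate; case: ifP => kM; last first.
    by rewrite expr0 mul1r subr0.
  have := branch_length_ge q q' k q0 q'q; rewrite -/l => H.
  have r2 : 0 <= 1 - r ^+ k.+1 by rewrite subr_ge0 exprn_ile1.
  rewrite -[_ / _ * l]mulrA [_^-1 * l]mulrC.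
  apply: le_trans (lerB (lexx _) (ler_wpM2l r2 H)).
  by rewrite mulrBl mul1r subKr.
rewrite big_split /= sumrN -big_mkcond /=.
rewrite -(big_ord_widen _ (fun k => (1 - r ^+ k.+1) / (k.+2%:R * k.+3%:R) * l)) ?leq_addl //.
rewrite -mulr_suml /decay_rate mulrBl mul1r lerB //.
exact: sum_branch_length.
Qed.

(** For [N = 0] the weighted sum is empty, and its upper bound is [decay_rate M r]. *)
Lemma decay_rate_ge0 {R : realType} (M : nat) (r : R) :
  0 <= r <= 1 -> 0 <= decay_rate M r.
Proof.
move=> r01; have := sum_weighted_branch_length 1 0 r M 0 ltr01 _ r01.
by rewrite big_ord0 addr0 mulr1 invr1 mulr1; apply; rewrite lexx ler01.
Qed.

(** * Chernoff bound over continued fraction cylinders *)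

(** The orbit condition stands in for irrationality: it suffices to read off [n] digits, and it
    passes to [gauss x] with [n] lowered by one. *)
Definition small_digit_sum {R : realType} (M n c : nat) : set R :=
  [set x | (forall i, (i <= n)%N -> 0 < iter i (@gauss R) x < 1) /\
           (\sum_(i < n) truncate M (cfd x i.+1) <= c)%N].

Lemma cfd_gauss {R : realType} (x : R) (n : nat) :
  cfd (gauss x) n.+1 = cfd x n.+2.
Proof. by rewrite /cfd /= -iterSr. Qed.

Lemma cfd1_gauss {R : realType} (x : R) : 0 < x < 1 ->
  (0 < cfd x 1)%N /\ x = ((cfd x 1)%:R + gauss x)^-1.
Proof.
move=> /andP[x0 x1].
have f1 : 1 <= Num.floor x^-1 by rewrite floor_ge_int invf_ge1 // ltW.
rewrite /cfd /=; split; first by rewrite absz_gt0 gt_eqF // (lt_le_trans _ f1).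
have -> : `|Num.floor x^-1|%:R = (Num.floor x^-1)%:~R :> R.
  by rewrite natr_absz ger0_norm // (le_trans _ f1).
by rewrite /gauss addrC subrK invrK.
Qed.

Lemma small_digit_sum_succ {R : realType} (M n c : nat) (x : R) :
  small_digit_sum M n.+1 c x ->
  [/\ (0 < cfd x 1)%N, x = ((cfd x 1)%:R + gauss x)^-1,
   0 < gauss x < 1,
   (truncate M (cfd x 1) <= c)%N &
   small_digit_sum M n (c - truncate M (cfd x 1))%N (gauss x)].
Proof.
move=> [xi]; rewrite big_ord_recl => sx.
have [c1 xE] := cfd1_gauss _ (xi 0%N isT).
split=> //; first exact: (xi 1%N isT).
  by apply: leq_trans sx; exact: leq_addr.
split=> [i ni|]; first by rewrite -iterSr; exact: xi.
rewrite leq_subRL; last by apply: leq_trans sx; exact: leq_addr.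
apply: leq_trans sx; rewrite leq_add2l.
by under eq_bigr do rewrite cfd_gauss.
Qed.

(** With consecutive convergents [p / q] and [p' / q'], this recovers a number from its Gauss
    remainder [y]. *)
Definition moebius {R : realType} (p p' q q' y : R) : R :=
  (p + p' * y) / (q + q' * y).

Lemma moebius_between {R : realType} (p p' q q' y : R) :
  0 < q -> 0 <= q' -> 0 < y < 1 ->
  Num.min (p / q) ((p + p') / (q + q')) <= moebius p p' q q' y <=
  Num.max (p / q) ((p + p') / (q + q')).
Proof.
move=> q0 q'0 /andP[y0 y1].
have qq : 0 < q + q' by apply: ltr_wpDr.
have qy : 0 < q + q' * y by apply: ltr_wpDr => //; rewrite mulr_ge0 // ltW.
(* The value at [y] is the convex combination, with weight [w], of the values at 0 and 1; this
   covers both signs of the determinant. *)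
pose w := y * (q + q') / (q + q' * y).
have w0 : 0 <= w by rewrite /w divr_ge0 ?mulr_ge0 // ltW.
have w1 : 0 <= 1 - w.
  rewrite subr_ge0 ler_pdivrMr // mul1r mulrDr lerD // 1?mulrC //.
  by rewrite ler_piMr // ltW.
have -> : moebius p p' q q' y = (1 - w) * (p / q) + w * ((p + p') / (q + q')).
  by rewrite /moebius /w; field; rewrite !gt_eqF.
move: (p / q) ((p + p') / (q + q')) => a b.
rewrite ge_min le_max.
have [ab|/ltW ab] := leP a b.
  by apply/andP; split; apply/orP; [left|right]; nra.
by apply/andP; split; apply/orP; [right|left]; nra.
Qed.

Lemma moebius_image_length {R : realType} (p p' q q' : R) :
  0 < q -> 0 <= q' ->
  `|(p + p') / (q + q') - p / q| = `|p' * q - p * q'| / (q * (q + q')).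
Proof.
move=> q0 q'0; have qq : 0 < q + q' by apply: ltr_wpDr.
have -> : (p + p') / (q + q') - p / q = (p' * q - p * q') / (q * (q + q')).
  by field; rewrite !gt_eqF.
by rewrite normrM normfV (ger0_norm (mulr_ge0 _ _)) // ltW.
Qed.

Lemma moebius_branch {R : realType} (p p' q q' k y : R) :
  0 < k + y ->
  moebius p p' q q' (k + y)^-1 = moebius (k * p + p') p (k * q + q') q y.
Proof.
move=> ky; rewrite /moebius.
have e u v : u + v * (k + y)^-1 = (k * u + v + u * y) / (k + y).
  by field; rewrite gt_eqF.
by rewrite !e invfM invrK mulrACA mulVf ?mulr1 // gt_eqF.
Qed.

(* Splitting on the first digit k composes the Moebius map with y |-> 1/(k+y),
   which preserves 0 <= q' <= q and |p' q - p q'|; this closes the induction. *)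
Lemma small_digit_sum_cover {R : realType} (M : nat) (r : R) (n c : nat)
    (p p' q q' : R) :
  0 < r <= 1 -> 0 < q -> 0 <= q' <= q ->
  exists B : set R, [/\ measurable B,
    moebius p p' q q' @` small_digit_sum M n c `<=` B &
    (lebesgue_measure B <= (decay_rate M r ^+ n / r ^+ c *
        (`|p' * q - p * q'| / (q * (q + q'))))%:E)%E].
Proof.
move=> r01; have /andP[r0 r1] := r01.
have r01' : 0 <= r <= 1 by rewrite ltW.
elim: n c p p' q q' => [|n IH] c p p' q q' q0 q'q; have /andP[q'0 _] := q'q.
  pose a := p / q; pose b := (p + p') / (q + q').
  exists `[Num.min a b, Num.max a b]%classic; split.
  - exact: measurable_itv.
  - move=> _ [y [/(_ 0%N isT) y01 _] <-] /=.
    by rewrite in_itv /=; apply: moebius_between.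
  - rewrite expr0 -moebius_image_length // -/a -/b lebesgue_measure_itv /=.
    have -> : (if ((Num.min a b)%:E < (Num.max a b)%:E)%E
        then ((Num.max a b)%:E - (Num.min a b)%:E)%E else 0%E) = `|b - a|%:E.
      rewrite lte_fin -EFinB; case: (ltgtP a b) => [ab|ab|->].
      + by rewrite ab gtr0_norm // subr_gt0.
      + by rewrite ab ltr0_norm ?subr_lt0 // opprB.
      + by rewrite ltxx subrr normr0.
    rewrite lee_fin ler_peMl // div1r invf_ge1 ?exprn_gt0 //.
    by rewrite exprn_ile1 // ltW.
set D := `|p' * q - p * q'|.
have D0 : 0 <= D by exact: normr_ge0.
have rho0 : 0 <= decay_rate M r by exact: decay_rate_ge0.
(* [u k] is the bound from the induction hypothesis for the digit [k.+1], which uses up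
   [truncate M k.+1] of the budget [c]. *)
pose u k := decay_rate M r ^+ n / r ^+ c * D *
  (r ^+ truncate M k.+1 * branch_length q q' k.+1).
have cst0 : 0 <= decay_rate M r ^+ n / r ^+ c * D.
  by rewrite mulr_ge0 // divr_ge0 // exprn_ge0 // ltW.
have u0 k : 0 <= u k.
  apply: mulr_ge0 => //; apply: mulr_ge0; last exact: branch_length_ge0.
  by rewrite exprn_ge0 // ltW.
have exB : forall k, exists B : set R, [/\ measurable B,
    (truncate M k.+1 <= c)%N -> moebius (k.+1%:R * p + p') p (k.+1%:R * q + q') q
      @` small_digit_sum M n (c - truncate M k.+1)%N `<=` B &
    (lebesgue_measure B <= (u k)%:E)%E].
  (* A digit that exceeds the budget contributes no point, and the natural subtraction would be
     wrong there; [B] is then empty. *)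
  move=> k; have [tc|tc] := leqP (truncate M k.+1) c; last first.
    by exists set0; split => //; rewrite measure0 lee_fin.
  have Q0 : 0 < k.+1%:R * q + q' by apply: ltr_wpDr => //; rewrite mulr_gt0.
  have qQ : 0 <= q <= k.+1%:R * q + q'.
    rewrite ltW //= -natr1 mulrDl mul1r addrAC lerDr addr_ge0 // mulr_ge0 //.
    exact: ltW.
  have [B [mB sB lB]] := IH (c - truncate M k.+1)%N (k.+1%:R * p + p') p _ _ Q0 qQ.
  exists B; split=> //; apply: le_trans lB _; rewrite lee_fin le_eqVlt.
  apply/orP; left; apply/eqP; rewrite /u /branch_length.
  have -> : p * (k.+1%:R * q + q') - (k.+1%:R * p + p') * q = - (p' * q - p * q').
    by ring.
  rewrite normrN -/D.
  have -> : k.+2%:R * q + q' = k.+1%:R * q + q' + q.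
    by rewrite -[k.+2%:R]natr1; ring.
  have rt0 : r ^+ truncate M k.+1 != 0 by rewrite expf_neq0 // gt_eqF.
  have rc0 : r ^+ (c - truncate M k.+1) != 0 by rewrite expf_neq0 // gt_eqF.
  have -> : r ^+ c = r ^+ (c - truncate M k.+1) * r ^+ truncate M k.+1.
    by rewrite -exprD subnK.
  move: (_ * (_ + q))^-1 (r ^+ (c - truncate M k.+1)) (r ^+ truncate M k.+1) rc0 rt0.
  by move=> w s t s0 t0; field; rewrite s0 t0.
have /choice[B HB] := exB; exists (\bigcup_k B k); split.
- by apply: bigcup_measurable => k _; have [] := HB k.
- move=> _ [x /small_digit_sum_succ[c1 xE g0 tc sx] <-].
  exists (cfd x 1).-1 => //; have [_ + _] := HB (cfd x 1).-1.
  rewrite prednK // => /(_ tc); apply; exists (gauss x) => //.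
  rewrite -moebius_branch -?xE // addr_gt0 ?ltr0n //.
  by case/andP: g0.
- have mB k : measurable (B k) by have [] := HB k.
  apply: (@le_trans _ _ (\sum_(0 <= k <oo) lebesgue_measure (B k))%E).
    apply: measure_sigma_subadditive => //.
    by apply: bigcup_measurable => k _; exact: mB.
  apply: lime_le; first by apply: is_cvg_nneseries => k _ _; exact: measure_ge0.
  apply: nearW => N; rewrite big_mkord.
  apply: (@le_trans _ _ (\sum_(k < N) (u k)%:E)%E).
    by apply: lee_sum => k _; have [] := HB k.
  rewrite sumEFin lee_fin -mulr_sumr exprS.
  have := sum_weighted_branch_length q q' r M N q0 q'q r01'.
  move/(ler_wpM2l cst0) => /le_trans; apply.
  rewrite le_eqVlt; apply/orP; left; apply/eqP.
  by ring.
Qed.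

(** Chernoff: [r] to the truncated digit sum has mean at most [decay_rate M r ^+ n], and is at least
    [r ^+ c] on this set. *)
Lemma small_digit_sum_measure {R : realType} (M : nat) (r : R) (n c : nat) :
  0 < r <= 1 ->
  exists B : set R, [/\ measurable B, small_digit_sum M n c `<=` B &
    (lebesgue_measure B <= (decay_rate M r ^+ n / r ^+ c)%:E)%E].
Proof.
move=> r01.
have le01 : (0 <= 0 :> R) && (0 <= 1 :> R) by rewrite lexx ler01.
(* The parameters [0 1 1 0] give the identity map. *)
have [B [mB sB lB]] := small_digit_sum_cover M r n c 0 1 1 0 r01 ltr01 le01.
exists B; split=> // [x sx|].
  by apply: sB; exists x => //; rewrite /moebius add0r mul1r mul0r addr0 divr1.
by move: lB; rewrite mul0r subr0 mulr1 normr1 addr0 mulr1 divr1 mulr1.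
Qed.

(** * Gauss orbits of irrational numbers *)

Lemma gauss_irrational {R : realType} (x : R) :
  irrational x -> irrational (gauss x).
Proof.
move=> xI [q _ qx]; apply: xI; exists ((q + (Num.floor x^-1)%:~R)^-1) => //.
by rewrite fmorphV rmorphD /= qx ratr_int /gauss subrK invrK.
Qed.

Lemma gauss_gt0_lt1 {R : realType} (x : R) : irrational x -> 0 < gauss x < 1.
Proof.
move=> xI; have /andP[f1 f2] := floor_itv x^-1.
rewrite lt_neqAle eq_sym subr_ge0 f1 ltrBlDr addrC.
rewrite -[X in _ < _ + X]/(1%:~R) -intrD f2 !andbT.
apply/negP => /eqP g0; apply: (gauss_irrational _ xI).
by rewrite g0; exists 0 => //; rewrite rmorph0.
Qed.

Lemma iter_gauss_gt0_lt1 {R : realType} (x : R) (n : nat) :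
  irrational x -> 0 < x < 1 -> 0 < iter n (@gauss R) x < 1.
Proof.
move=> xI x01; have itI m : irrational (iter m (@gauss R) x).
  by elim: m => //= m; exact: gauss_irrational.
by case: n => //= n; exact: gauss_gt0_lt1.
Qed.

(** * Choice of the truncation level and of [r] *)

Lemma onem_expr_ge {R : realType} (t : R) (n : nat) :
  0 <= t <= 1 -> 1 - n%:R * t <= (1 - t) ^+ n.
Proof.
move=> /andP[t0 t1]; elim: n => [|n IH]; first by rewrite mul0r subr0 expr0.
rewrite exprSr -natr1; have n0 : 0 <= n%:R :> R by [].
move: (n%:R) ((1 - t) ^+ n) IH n0 => m e IH m0; nra.
Qed.

(** A converse to Bernoulli's inequality: while [n t <= 1], the second-order term costs at most half
    of the linear one. *)
Lemma onem_expr_le {R : realType} (t : R) (n : nat) :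
  0 <= t <= 1 -> n%:R * t <= 1 -> (1 - t) ^+ n <= 1 - n%:R * t / 2.
Proof.
move=> /andP[t0 t1]; elim: n => [|n IH]; first by rewrite !mul0r subr0 expr0.
rewrite exprSr -natr1; have n0 : 0 <= n%:R :> R by [].
move=> nt; have {IH} := IH _; move: (n%:R) ((1 - t) ^+ n) n0 nt => m e m0 nt IH.
have {}IH : e <= 1 - m * t / 2 by apply: IH; nra.
have := ler_wpM2r (_ : 0 <= 1 - t) IH; rewrite subr_ge0 => /(_ t1).
nra.
Qed.

(* The sum is the mean of [truncate M a_1] against the weights
   [1 / ((k+1) (k+2))]; it dominates a sixth of the harmonic sum. *)
Lemma truncated_mean_unbounded {R : realType} (K : R) :
  exists M, K < \sum_(k < M.+1) k.+1%:R / (k.+2%:R * k.+3%:R).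
Proof.
apply/not_existsP => H; apply: (@dvg_harmonic R); apply: nondecreasing_is_cvgn.
  move=> m n mn; rewrite /series /= (big_cat_nat (leq0n m) mn) /= lerDl.
  by apply: sumr_ge0 => i _; rewrite invr_ge0.
(* The constant comes from [(k+2)(k+3) <= 6 (k+1)^2], an equality at [k = 0]. *)
exists (6 * K) => _ [N _ <-]; rewrite /series /= big_mkord.
apply: (@le_trans _ _ (\sum_(i < N.+1) harmonic i)).
  by rewrite big_ord_recr /= lerDl invr_ge0.
have := H N => /negP; rewrite -leNgt => HN.
apply: (@le_trans _ _ (6 * \sum_(k < N.+1) k.+1%:R / (k.+2%:R * k.+3%:R))); last first.
  by rewrite ler_pM2l.
rewrite mulr_sumr; apply: ler_sum => k _ /=.
have k0 : 0 <= (k : nat)%:R :> R by [].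
rewrite -[k.+3%:R]natr1 -[k.+2%:R]natr1 -[k.+1%:R]natr1.
move: (k : nat)%:R k0 => u u0.
rewrite mulrA ler_pdivlMr; last by rewrite mulr_gt0 //; lra.
rewrite mulrC ler_pdivrMr; last by lra.
nra.
Qed.

(** For [r = 1 - t], compare linear terms in [t]: half the truncated mean on the left against [C] on
    the right, whence the [2 * C] below. The choice [t = 1/(M+1)] keeps [(k+1) t <= 1] for all
    [k < M]. *)
Lemma decay_rate_lt {R : realType} (C : nat) :
  exists M (r : R), 0 < r <= 1 /\ decay_rate M r < r ^+ C.
Proof.
have [M0 EM] := truncated_mean_unbounded (2 * C%:R : R).
pose M := M0.+1; pose t : R := M.+1%:R^-1.
have t0 : 0 < t by rewrite invr_gt0.
have t1 : t < 1 by rewrite invf_lt1 // ltr1n.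
have t01 : 0 <= t <= 1 by rewrite !ltW.
exists M, (1 - t); split; first by apply/andP; split; lra.
apply: lt_le_trans (onem_expr_ge _ C t01).
apply: (@le_lt_trans _ _ (1 - t / 2 * \sum_(k < M) k.+1%:R / (k.+2%:R * k.+3%:R))).
  rewrite lerB // mulr_sumr; apply: ler_sum => k _.
  rewrite mulrA ler_wpM2r ?invr_ge0 ?mulr_ge0 //.
  have := onem_expr_le t k.+1 t01; rewrite /t ler_pdivrMr // mul1r ler_nat.
  move=> /(_ (ltnW (ltn_ord k))); rewrite -/t; lra.
move: EM; rewrite -/M; move: (\sum_(k < M) _) => E EM.
rewrite ltrD2l ltrN2; nra.
Qed.

(** * Borel-Cantelli and the almost sure limit *)

Lemma lim_sup_set_geometric {R : realType} (B : nat -> set R) (x : R) :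
  0 <= x < 1 -> (forall n, measurable (B n)) ->
  (forall n, (lebesgue_measure (B n) <= (x ^+ n)%:E)%E) ->
  lebesgue_measure (lim_sup_set B) = 0%E.
Proof.
move=> /andP[x0 x1] mB lB; apply: lim_sup_set_cvg0 => //.
apply: (@le_lt_trans _ _ ((1 - x)^-1)%:E); last by rewrite ltry.
apply: lime_le; first by apply: is_cvg_nneseries => k _ _; exact: measure_ge0.
apply: nearW => N; rewrite big_mkord.
apply: (@le_trans _ _ (\sum_(k < N) (x ^+ k)%:E)%E); first by apply: lee_sum => k _; exact: lB.
rewrite sumEFin lee_fin -[leRHS]mul1r ler_pdivlMr ?subr_gt0 //.
have := subrX1 x N; rewrite mulrC => E.
have -> : (\sum_(k < N) x ^+ k) * (1 - x) = 1 - x ^+ N.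
  by rewrite -[RHS]opprB E -mulrN opprB.
by rewrite gerBl exprn_ge0.
Qed.

(** With budget [C * n], the Chernoff bound is the [n]-th power of [decay_rate M r / r ^+ C < 1],
    hence summable. *)
Lemma ae_digit_sum {R : realType} (C : nat) :
  {ae (@lebesgue_measure R), forall a : R, 0 < a < 1 -> irrational a ->
    exists M, \forall n \near \oo,
      (C * n < \sum_(i < n) truncate M (cfd a i.+1))%N}.
Proof.
have [M [r [r01 rho]]] := @decay_rate_lt R C.
have /andP[r0 r1] := r01.
have rC : 0 < r ^+ C by rewrite exprn_gt0.
have /choice[B HB] := fun n => small_digit_sum_measure M r n (C * n) r01.
exists (lim_sup_set B); split.
- apply: bigcapT_measurable => n; apply: bigcup_measurable => k _.
  by have [] := HB k.
- apply: (@lim_sup_set_geometric _ _ (decay_rate M r / r ^+ C)) => [|n|n].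
  + rewrite ltr_pdivrMr // mul1r rho andbT divr_ge0 //; last exact: ltW.
    by apply: decay_rate_ge0; rewrite r1 ltW.
  + by have [] := HB n.
  + by have [_ _] := HB n; rewrite expr_div_n exprM.
- move=> a; apply: contra_notP => aB a01 aI; exists M.
  have [n nB] : exists n, forall j, (n <= j)%N -> ~ B j a.
    apply: contrapT => H; apply: aB => n _; apply: contrapT => H2; apply: H.
    by exists n => j nj Bj; apply: H2; exists j.
  exists n => // j nj; rewrite ltnNge; apply/negP => sj; apply: (nB j nj).
  have [_ sB _] := HB j; apply: sB; split=> // i _.
  exact: iter_gauss_gt0_lt1.
Qed.

Lemma ae_Salpha_pinfty {R : realType} (f : nat -> nat) :
  (forall n, (1 <= n)%N -> (1 <= f n <= n)%N) ->
  (fun n => (f n)%:R / n%:R : R) @ \oo --> 0 ->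
  {ae (@lebesgue_measure R), forall a : R, a \in `]0, 1[ -> irrational a ->
      (fun n => Salpha a n (f n)) @ \oo --> +oo}.
Proof.
(* Countably many [C] leave a single null set. *)
move=> Hf1 Hfo; have := ae_foralln (@ae_digit_sum R).
apply: filterS => a aC; rewrite in_itv /= => a01 aI.
(* The extra 1 in [A + 1 <= C] pays for the loss [f n * M], which is at most [n] once
   [f n / n <= 1/(M+1)]. *)
apply/cvgryPge => A; pose C := (Num.bound `|A|).+1.
have AC : A + 1 <= C%:R.
  by rewrite -natr1 lerD2r ltW // (le_lt_trans (ler_norm A)) // archi_boundP.
have [M HM] := aC C a01 aI.
have e0 : 0 < M.+1%:R^-1 :> R by rewrite invr_gt0.
have Hf : \forall n \near \oo, (f n)%:R / n%:R <= M.+1%:R^-1 :> R.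
  have /cvgrPdist_le /(_ _ e0) := Hfo; apply: filterS => n.
  by rewrite sub0r normrN => /(le_trans (ler_norm _)).
near=> n.
have n1 : (1 <= n)%N by near: n; exists 1%N.
have n0 : 0 < n%:R :> R by rewrite ltr0n.
apply: (@Sroot_ge _ _ (fun i => (truncate M (cfd a i))%:R) M%:R).
- exact: Hf1.
- by move=> i; rewrite ler0n ler_nat /truncate; case: ifP.
- by move=> i; rewrite ler_nat /truncate; case: ifP.
have sC : (C * n < \sum_(i < n) truncate M (cfd a i.+1))%N by near: n; exact: HM.
have fM : (f n)%:R / n%:R <= M.+1%:R^-1 :> R by near: n; exact: Hf.
rewrite -natr_sum; apply: (@le_trans _ _ (C * n)%:R); last by rewrite ler_nat ltnW.
apply: (@le_trans _ _ ((A + 1) * n%:R)); last by rewrite natrM ler_pM2r.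
rewrite mulrC mulrDl lerD2l mul1r.
move: fM; rewrite ler_pdivrMr // mulrC ler_pdivlMr ?ltr0n // => fM.
by apply: le_trans fM; rewrite ler_wpM2l // ler_nat.
Unshelve. all: by end_near. Qed.

Theorem theorem5p1 (R : realType) (f : nat -> nat)
  (HF : forall (x : nat -> R) (L : nat), (1 <= L)%N ->
        (forall i, (1 <= i)%N -> 0 < x i) ->
        (forall i, (1 <= i)%N -> x (i + L)%N = x i) ->
        exists F : R -> R,
          (forall c, c \in `[0, 1] -> (fun k => FX x L k c) @ \oo --> F c) /\
          {within `[0, 1], continuous F})
  (Hf1 : forall n, (1 <= n)%N -> (1 <= f n <= n)%N)
  (Hfo : (fun n => (f n)%:R / n%:R : R) @ \oo --> 0) :
  {ae (@lebesgue_measure R), forall a : R, a \in `]0, 1[ -> irrational a ->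
      limn_esup (fun n => (Salpha a n (f n))%:E) = +oo%E} /\
  ({ae (@lebesgue_measure R), forall a : R, a \in `]0, 1[ -> irrational a ->
      forall c : R, c \in `]0, 1] ->
        limn_esup (fun n => (Salphac a n c)%:E) =
        limn_einf (fun n => (Salphac a n c)%:E)} ->
   {ae (@lebesgue_measure R), forall a : R, a \in `]0, 1[ -> irrational a ->
      (fun n => Salpha a n (f n)) @ \oo --> +oo}).
Proof.
have H := ae_Salpha_pinfty _ Hf1 Hfo.
split=> [|_ //].
apply: negligibleS H => a; apply: contra_not => Ha a01 aI.
(* Divergence to [+oo] in the extended reals forces the upper limit to be [+oo]. *)
by apply: (cvg_limn_einf_sup _).2; apply/cvgeryP; exact: Ha.
Qed.
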